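(* Let $S$ be the set containing 8 copies of each positive integer that is not a multiple of 4, and let $T$ be the set containing 8 copies of each positive integer that is not congruent to 2 modulo 4. Let $D_S(N)$ be the number of partitions of $N$ into an odd number of distinct elements of $S$, and let $D_T(N)$ be the number of partitions of $N$ into distinct elements of $T$ (with no restriction on the number of parts). Then, for every integer $N\geq 2$, $$D_S(N)=8\,D_T(N-2).$$
   Context: A ''set containing several copies'' of certain integers means a set of colored integers: the different copies of the same integer are regarded as distinct (distinguishable) elements, each having that integer as its value. A partition of $N$ into distinct elements of $X$ is a finite subset of $X$ whose elements have values summing to $N$ (so each copy is used at most once, but different copies of the same integer may be used together, and subsets using different copies are counted as different); the number of parts is the cardinality of this subset. The empty partition is the unique partition of $0$ when no restriction on the number of parts is imposed. *)

(* Defs.v *)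
From mathcomp Require Import all_boot finmap.
From mathcomp Require Import boolp classical_sets functions cardinality.

Set Implicit Arguments.
Unset Strict Implicit.
Unset Printing Implicit Defensive.

Local Open Scope classical_set_scope.
Local Open Scope nat_scope.

(* The colored integer (n, i) is the i-th of the k copies of n; its value
   is n. *)
Definition colored (k : nat) := (nat * 'I_k)%type.

Definition copies (k : nat) (P : set nat) : set (colored k) :=
  [set c | P c.1].

Arguments copies : clear implicits.

Definition partitions (k : nat) (X : set (colored k)) (N : nat) :
    set {fset colored k} :=
  [set A : {fset colored k} | [set` A] `<=` X /\ \sum_(c <- A) c.1 = N].

(* fset_set sends an infinite set to the empty fset, so this is the number of
   elements of E only when E is finite; the finiteness lemmas below show that
   this holds for the sets counted by D_S and D_T. *)
Definition num_elements (T : choiceType) (E : set T) : nat := #|` fset_set E|.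

Definition set_S : set (colored 8) := copies 8 [set n | 0 < n /\ ~~ (4 %| n)].

Definition set_T : set (colored 8) := copies 8 [set n | 0 < n /\ n %% 4 != 2].

Definition D_S (N : nat) : nat :=
  num_elements (partitions set_S N `&` [set A : {fset colored 8} | odd #|` A|]).

Definition D_T (N : nat) : nat := num_elements (partitions set_T N).

Lemma finite_partitions (k : nat) (X : set (colored k)) (N : nat) :
  (forall c, X c -> 0 < c.1) -> finite_set (partitions X N).
Proof.
move=> X0.
pose B : {fset colored k} :=
  seq_fset tt [seq (n, i) | n <- iota 0 N.+1, i <- enum 'I_k].
apply: (@sub_finite_set _ _ [set` fpowerset B]); last exact: finite_fset.
move=> A [AX AN] /=; rewrite fpowersetE; apply/fsubsetP => -[n i] cA.
rewrite seq_fsetE; apply/allpairsP; exists (n, i); split; rewrite ?mem_enum //.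
rewrite mem_iota add0n /= ltnS -AN (big_rem (n, i)) //=.
exact: leq_addr.
Qed.

Lemma finite_partitions_S (N : nat) :
  finite_set (partitions set_S N `&` [set A : {fset colored 8} | odd #|` A|]).
Proof.
by apply: sub_finite_set (finite_partitions (X := set_S) N _) => [A []|c []].
Qed.

Lemma finite_partitions_T (N : nat) : finite_set (partitions set_T N).
Proof. by apply: finite_partitions => c []. Qed.

(* Main.v *)
Require Import Defs.
From mathcomp Require Import all_boot finmap all_order all_algebra.
From mathcomp Require Import boolp classical_sets functions cardinality.
From mathcomp Require Import zify ring.
From Stdlib Require Import Setoid Morphisms.

Set Implicit Arguments.
Unset Strict Implicit.
Unset Printing Implicit Defensive.

Import GRing.Theory Num.Theory.

(** Signing each part by -1 separates the partitions with an odd number of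
parts: with A the product of (1 + x^n) and B the product of (1 - x^n) over the
n not divisible by 4, and C the product of (1 + x^n) over the n not congruent
to 2 modulo 4, the generating functions of 2 D_S and of D_T are A^8 - B^8 and
C^8. So the theorem is the coefficientwise reading of
    A^8 - B^8 = 16 x + 16 x^2 C^8     ([eight_power_identity]).

Write E_k for the product of the (1 - x^(k n)), n >= 1. Since (1 + x^n) is
(1 - x^(2n)) / (1 - x^n), the three products are the quotients
    A = E_2 E_4 / (E_1 E_8),  B = E_1 / E_4,  C = E_2^2 E_8 / (E_1 E_4^2),
and after clearing denominators the identity is a combination of Jacobi's
aequatio identica satis abstrusa
    E_2^24 = E_1^16 E_4^8 + 16 x E_1^8 E_4^16     ([jacobi_abstruse])
and of its image under x -> x^2 ([jacobi_abstruse_sq]).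

Jacobi's equation is proved with Ramanujan's theta functions
    phi(q) = 1 + 2 sum_(j >= 1) q^(j^2),  psi(q) = sum_(j >= 0) q^(j(j+1)/2).
The Jacobi triple product, obtained from the q-binomial theorem by letting the
length grow, writes both as quotients of the E_k ([Phi_euler], [Phi_opp_euler],
[Psi_euler]); separating even and odd exponents in the series gives
    phi(q) + phi(-q) = 2 phi(q^4),  phi(q) - phi(-q) = 4 q psi(q^8),
and the quotients give phi(q) phi(-q) = phi(-q^2)^2 and
phi(q) psi(q^2) = psi(q)^2. The missing relation
    phi(q)^2 + phi(-q)^2 = 2 phi(q^2)^2     ([Phi_sq_add])
follows because the difference D(q) of its two sides satisfies
D(q) = -2 D(q^2), which forces every coefficient of D to vanish. Multiplying,
phi(q)^4 - phi(-q)^4 = 16 q psi(q^2)^4, which is Jacobi's equation once phi and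
psi are replaced by their products.

Formal power series are handled as polynomials modulo 'X^M, and infinite
products and series by their first M factors or terms: for q a multiple of 'X,
what is left out is 1, respectively 0, modulo 'X^M. Division by a series with
constant term 1 becomes [congX_cancel]. *)

Local Open Scope ring_scope.

(** * Gaussian binomials and the finite triple product *)

Lemma bin2D (m n : nat) : 'C(m + n, 2) = ('C(m, 2) + 'C(n, 2) + m * n)%N.
Proof.
elim: n => [|n IHn]; first by rewrite addn0 bin0n muln0 !addn0.
by rewrite addnS !binS !bin1 IHn mulnS; lia.
Qed.

Section GaussianBinomials.

Variables (R : comNzRingType) (q : R).

(** The Gaussian binomial coefficient, defined by its q-Pascal rule so that it
is a polynomial in q by construction. *)
Fixpoint gbinom (n k : nat) : R :=
  match n, k with
  | _, 0 => 1
  | 0, _.+1 => 0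
  | n'.+1, k'.+1 => gbinom n' k' + q ^+ k * gbinom n' k
  end.

(** The q-Pochhammer symbol (q; q)_n. *)
Definition qpoch (n : nat) : R := \prod_(i < n) (1 - q ^+ i.+1).

Lemma gbinom0 (n : nat) : gbinom n 0 = 1.
Proof. by case: n. Qed.

Lemma gbinomS (n k : nat) :
  gbinom n.+1 k.+1 = gbinom n k + q ^+ k.+1 * gbinom n k.+1.
Proof. by []. Qed.

Lemma gbinom_small (n k : nat) : (n < k)%N -> gbinom n k = 0.
Proof.
elim: n k => [|n IHn] [|k] //= ltnk.
by rewrite !IHn ?mulr0 ?addr0 // ltnW.
Qed.

Lemma qpochS (n : nat) : qpoch n.+1 = qpoch n * (1 - q ^+ n.+1).
Proof. by rewrite /qpoch big_ord_recr. Qed.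

(** The quotient formula for Gaussian binomials, with the denominators cleared;
it is what makes the central ones tend to the inverse of an Euler product. *)
Lemma gbinom_qpoch (n k : nat) : (k <= n)%N ->
  gbinom n k * (qpoch k * qpoch (n - k)) = qpoch n.
Proof.
elim: n k => [|n IHn] [|k] lekn //.
- by rewrite gbinom0 subn0 /qpoch big_ord0 !mul1r.
- by rewrite gbinom0 subn0 /qpoch big_ord0 !mul1r.
rewrite gbinomS subSS; rewrite ltnS in lekn.
have:= lekn; rewrite leq_eqVlt => /predU1P[-> | ltkn].
  have:= IHn n (leqnn n); rewrite subnn => IH.
  rewrite [gbinom n n.+1]gbinom_small // mulr0 addr0 ?subnn.
  rewrite [in RHS]qpochS -IH qpochS.
  by ring.
have E1 := IHn k lekn; have E2 := IHn k.+1 ltkn.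
have dnk : (n - k = (n - k.+1).+1)%N by lia.
have dn : q ^+ n.+1 = q ^+ k.+1 * q ^+ (n - k.+1).+1.
  by rewrite -exprD; congr (_ ^+ _); lia.
rewrite dnk in E1 *; rewrite mulrDl [in RHS]qpochS dn.
have -> : gbinom n k * (qpoch k.+1 * qpoch (n - k.+1).+1)
        = (1 - q ^+ k.+1) * qpoch n by rewrite -E1 qpochS; ring.
have -> : q ^+ k.+1 * gbinom n k.+1 * (qpoch k.+1 * qpoch (n - k.+1).+1)
        = q ^+ k.+1 * (1 - q ^+ (n - k.+1).+1) * qpoch n.
  by rewrite -E2 [qpoch (n - _).+1]qpochS; ring.
ring.
Qed.

(** Peeling off the factor i = 0 replaces z by z * q in the remaining ones, so
the induction must hold for every z. Keeping y as well, instead of setting it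
to 1, spares negative powers of q in the triple product. *)
Lemma gbinom_theorem (y z : R) (n : nat) :
  \prod_(i < n) (y + z * q ^+ i)
  = \sum_(k < n.+1) q ^+ 'C(k, 2) * gbinom n k * z ^+ k * y ^+ (n - k).
Proof.
elim: n z => [|n IHn] z.
  by rewrite big_ord0 big_ord1 gbinom0 bin0n !expr0 !mulr1.
pose t k := q ^+ 'C(k, 2) * gbinom n k * (z * q) ^+ k.
pose T k := q ^+ 'C(k, 2) * gbinom n.+1 k * z ^+ k.
have TS k : T k.+1 = z * t k + t k.+1.
  rewrite /T /t gbinomS (binS k 1) bin1 !exprMn exprD [z ^+ _]exprS.
  by ring.
have -> : \prod_(i < n.+1) (y + z * q ^+ i)
    = (y + z) * \sum_(k < n.+1) t k * y ^+ (n - k).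
  rewrite big_ord_recl expr0 mulr1 -IHn; congr (_ * _).
  by apply: eq_bigr => i _; rewrite exprS mulrA.
transitivity (\sum_(k < n.+2) T k * y ^+ (n.+1 - k)); last by [].
rewrite mulrDl !mulr_sumr big_ord_recl [RHS]big_ord_recl /=.
under [in RHS]eq_bigr => k _ do rewrite /bump /= add1n TS subSS mulrDl.
rewrite big_split /= [X in _ = _ + (_ + X)]big_ord_recr /=.
have -> : t n.+1 = 0 by rewrite /t gbinom_small // mulr0 mul0r.
have -> : T 0%N = t 0%N by rewrite /T /t !gbinom0 !expr0.
rewrite mul0r addr0 !subn0 exprS mulrCA -addrA; congr (_ + _).
rewrite addrC; congr (_ + _).
  by apply: eq_bigr => k _; rewrite mulrA.
apply: eq_bigr => k _; rewrite /bump /= add1n.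
have -> : (n - k = (n - k.+1).+1)%N by have := ltn_ord k; lia.
by rewrite [y ^+ _.+1]exprS mulrCA.
Qed.

End GaussianBinomials.

(** The q-binomial theorem in base q^d with 2m factors, centred at its middle
term: after dividing by the power of q carried by that term, the first m
factors become those in b and the last m those in a. The two sums collect the
terms to the right (middle included) and to the left of the middle, whose
exponents are d * 'C(j, 2) + a * j and its mirror image. *)
Lemma finite_jacobi_triple (R : idomainType) (q : R) (a b m : nat) :
  q != 0 -> let d := (a + b)%N in
  \prod_(i < m) ((1 + q ^+ (a + d * i)) * (1 + q ^+ (b + d * i)))
  = \sum_(j < m.+1)
      gbinom (q ^+ d) (m + m) (m + j) * q ^+ (d * 'C(j, 2) + a * j)
  + \sum_(j < m)
      gbinom (q ^+ d) (m + m) (m - j.+1) * q ^+ (d * 'C(j.+1, 2) + b * j.+1).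
Proof.
move=> q0 d; case: m => [|m].
  by rewrite !big_ord0 big_ord1 gbinom0 bin0n !muln0 expr0 mulr1 addr0.
(* The exponent of q in the middle term of the q-binomial expansion. *)
pose e := (d * 'C(m.+1, 2) + m.+1 * (b + d * m))%N.
apply: (mulfI (expf_neq0 e q0)).
have := gbinom_theorem (q ^+ d) (q ^+ (b + d * m)) 1 (m.+1 + m.+1).
rewrite big_split_ord /= (reindex_inj rev_ord_inj) /=.
under eq_bigr => i _.
  rewrite mul1r -exprM (_ : _ + _
    = q ^+ (d * (m - i)) * (1 + q ^+ (b + d * i))); last first.
    rewrite mulrDr mulr1 -exprD addrC; congr (_ + q ^+ _).
    by have := ltn_ord i; rewrite mulnBr; nia.
  over.
under [X in _ * X = _]eq_bigr => i _.
  rewrite mul1r -exprM (_ : _ + _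
    = q ^+ (b + d * m) * (1 + q ^+ (a + d * i))); last first.
    by rewrite mulrDr mulr1 -exprD; congr (_ + q ^+ _); rewrite /d; lia.
  over.
rewrite !big_split /= prodr_const card_ord -exprM.
have -> : \prod_(i < m.+1) q ^+ (d * (m - i)) = q ^+ (d * 'C(m.+1, 2)).
  rewrite -expr_sum; congr (_ ^+ _); rewrite -big_distrr /=; congr muln.
  rewrite -bin2_sum (reindex_inj rev_ord_inj) /= big_mkord.
  by apply: eq_bigr => i _; rewrite subSS; have := ltn_ord i; lia.
have -> (A B C D : R) : C * A * (D * B) = C * D * (B * A) by ring.
rewrite -exprD [X in q ^+ (_ + X)]mulnC => ->.
have coefE (g : R) (s t u v k : nat) : (d * s + t * u = e + v)%N ->
    (q ^+ d) ^+ s * g * 1 ^+ k * (q ^+ t) ^+ u = q ^+ e * (g * q ^+ v).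
  move=> h; rewrite expr1n mulr1 mulrCA -exprD -h exprD !exprM.
  by rewrite [_ * g]mulrC mulrA.
rewrite -addnS (@big_split_ord _ _ _ m.+1 m.+2) /= addrC mulrDr.
congr (_ + _); rewrite mulr_sumr.
  apply: eq_bigr => j _; apply: coefE.
  have [l dm] : exists l, (m.+1 = j + l)%N.
    by exists (m.+1 - j)%N; have := ltn_ord j; lia.
  rewrite /e (_ : m.+1 + m.+1 - (m.+1 + j) = l)%N; last by lia.
  by rewrite bin2D /d; nia.
rewrite (reindex_inj rev_ord_inj) /=; apply: eq_bigr => j _; apply: coefE.
rewrite !subSS; have [l dm] : exists l, (m = j + l)%N.
  by exists (m - j)%N; have := ltn_ord j; lia.
have -> : (m - j = l)%N by lia.
have dSm : (m.+1 = l + j.+1)%N by lia.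
have dC : 'C(m.+1, 2) = ('C(l, 2) + 'C(j.+1, 2) + l * j.+1)%N.
  by rewrite -bin2D -dSm.
rewrite /e dC (_ : m.+1 + m.+1 - l = m.+1 + j.+1)%N; last by lia.
(* The exponents match only through 2 * 'C(j + 1, 2) = (j + 1) * j. *)
have dbl : (d * (2 * 'C(j.+1, 2)) = d * (j.+1 * j))%N.
  by rewrite -(mul_bin_diag j.+1 1) bin1.
clear e dC dSm; clearbody d; move: dm dbl.
by move: 'C(l, 2) 'C(j.+1, 2) (nat_of_ord j) => u v w ->; nia.
Qed.

(** * Polynomials as truncated power series *)

(** Congruence modulo 'X^M. It is stated as an existential rather than as the
boolean divisibility, so that a proof of it is used for setoid rewriting and
not as an equation between booleans. *)
Definition congX (F : fieldType) (M : nat) (p q : {poly F}) : Prop :=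
  exists r, p - q = r * 'X^M.

Lemma congX_refl (F : fieldType) (M : nat) (p : {poly F}) : congX M p p.
Proof. by exists 0; rewrite subrr mul0r. Qed.

#[global] Hint Resolve congX_refl : core.

Lemma congX_eq (F : fieldType) (M : nat) (p q : {poly F}) :
  p = q -> congX M p q.
Proof. by move=> ->. Qed.

Section Congruence.

Variables (F : fieldType) (M : nat).
Implicit Types p q r : {poly F}.

Local Notation "p ~ q" := (congX M p q) (at level 70).

Lemma congXP p q : reflect (p ~ q) ('X^M %| p - q).
Proof. exact: dvdpP. Qed.

#[global] Instance congX_equiv : Equivalence (@congX F M).
Proof.
split=> [p|p q [r h]|p q s [r h] [t k]]; first exact: congX_refl.
  by exists (- r); rewrite mulNr -h opprB.
by exists (r + t); rewrite mulrDl -h -k subrKA.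
Qed.

#[global] Instance congX_add :
  Proper (@congX F M ==> @congX F M ==> @congX F M) +%R.
Proof.
move=> p p' [r h] q q' [s k]; exists (r + s); rewrite mulrDl -h -k.
by ring.
Qed.

#[global] Instance congX_opp : Proper (@congX F M ==> @congX F M) -%R.
Proof. by move=> p q [r h]; exists (- r); rewrite mulNr -h opprD. Qed.

#[global] Instance congX_mul :
  Proper (@congX F M ==> @congX F M ==> @congX F M) *%R.
Proof.
move=> p p' [r h] q q' [s k]; exists (p * s + r * q').
by rewrite mulrDl -mulrA -k mulrAC -h; ring.
Qed.

#[global] Instance congX_exp :
  Proper (@congX F M ==> eq ==> @congX F M) (@GRing.exp {poly F}).
Proof.
move=> p p' hp n _ <-; elim: n => [|n IHn]; first by rewrite !expr0.
by rewrite !exprS IHn hp.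
Qed.

Lemma congX_sum n (f g : 'I_n -> {poly F}) :
  (forall i, f i ~ g i) -> \sum_(i < n) f i ~ \sum_(i < n) g i.
Proof. by move=> h; elim/big_rec2: _ => // i p q _ ->; rewrite (h i). Qed.

Lemma congX_prod n (f g : 'I_n -> {poly F}) :
  (forall i, f i ~ g i) -> \prod_(i < n) f i ~ \prod_(i < n) g i.
Proof. by move=> h; elim/big_rec2: _ => // i p q _ ->; rewrite (h i). Qed.

(** A polynomial with nonzero constant term is coprime to 'X^M, hence
invertible modulo 'X^M. *)
Lemma congX_cancel p q r : p.[0] != 0 -> p * q ~ p * r -> q ~ r.
Proof.
move=> p0 /congXP; rewrite -mulrBr Gauss_dvdpr; first by move/congXP.
by rewrite coprimep_expl // coprimep_sym coprimepX.
Qed.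

Lemma congX_comp r p q : 'X %| r -> p ~ q -> p \Po r ~ q \Po r.
Proof.
move=> rX /congXP/(dvdp_comp_poly r); rewrite comp_polyB comp_Xn_poly => h.
by apply/congXP; apply: dvdp_trans h; apply: dvdp_exp2r.
Qed.

Lemma congX_exp0 q n : 'X %| q -> (M <= n)%N -> q ^+ n ~ 0.
Proof.
move=> qX leMn; apply/congXP; rewrite subr0.
exact: dvdp_trans (dvdp_exp2l _ leMn) (dvdp_exp2r _ qX).
Qed.

Lemma congX_mul_exp0 p q n : 'X %| q -> (M <= n)%N -> p * q ^+ n ~ 0.
Proof. by move=> qX leMn; rewrite congX_exp0 // mulr0. Qed.

Lemma sum_congX_trunc (u : nat -> {poly F}) n : (M <= n)%N ->
    (forall i, (M <= i)%N -> u i ~ 0) ->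
  \sum_(i < n) u i ~ \sum_(i < M) u i.
Proof.
move=> leMn u0; rewrite -(subnKC leMn) big_split_ord /=.
have -> : \sum_(i < n - M) u (M + i)%N ~ 0; last by rewrite addr0.
by elim/big_rec: _ => // i p _ ->; rewrite u0 ?addr0 ?leq_addr.
Qed.

Lemma prod_congX_trunc (u : nat -> {poly F}) n : (M <= n)%N ->
    (forall i, (M <= i)%N -> u i ~ 1) ->
  \prod_(i < n) u i ~ \prod_(i < M) u i.
Proof.
move=> leMn u1; rewrite -(subnKC leMn) big_split_ord /=.
have -> : \prod_(i < n - M) u (M + i)%N ~ 1; last by rewrite mulr1.
by elim/big_rec: _ => // i p _ ->; rewrite u1 ?mulr1 ?leq_addr.
Qed.

End Congruence.

Lemma congX_coef (F : fieldType) (M : nat) (p q : {poly F}) :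
  congX M p q <-> forall i, (i < M)%N -> p`_i = q`_i.
Proof.
split=> [[r h] i ltiM|h].
  by apply/eqP; rewrite -subr_eq0 -coefB h coefMXn ltiM.
exists (drop_poly M (p - q)); rewrite -{1}[p - q](poly_take_drop M).
rewrite (_ : take_poly M _ = 0) ?add0r //; apply/polyP=> i.
rewrite coef_take_poly coef0; case: ifP => // /h; rewrite coefB => ->.
by rewrite subrr.
Qed.

(** Comparing coefficients, p`_i is 0 for i odd and c * p`_(i / 2) for i even,
so the vanishing of p`_0 spreads to all coefficients below M. *)
Lemma congX_descent (F : fieldType) (M : nat) (c : F) (p : {poly F}) :
  p`_0 = 0 -> congX M p (c%:P * (p \Po 'X^2)) -> congX M p 0.
Proof.
move=> p0 /congX_coef h; apply/congX_coef => i.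
elim/ltn_ind: i => [[|i]] IHi ltiM; first by rewrite p0 coef0.
rewrite h // coefCM coef_comp_poly_Xn // coef0.
case: ifP => [_|]; last by rewrite mulr0.
by rewrite IHi ?coef0 ?mulr0 //; lia.
Qed.

Lemma big_even_odd (R : Type) (idx : R) (op : Monoid.com_law idx)
    (u : nat -> R) (n : nat) :
  \big[op/idx]_(i < n + n) u i
  = op (\big[op/idx]_(i < n) u (i + i)%N) (\big[op/idx]_(i < n) u (i + i).+1).
Proof.
elim: n => [|n IHn]; first by rewrite !big_ord0 Monoid.mulm1.
by rewrite addnS addSn !big_ord_recr /= IHn -Monoid.mulmA Monoid.mulmACA.
Qed.

Lemma big_mod4 (R : comNzRingType) (u : nat -> R) (n : nat) :
  \prod_(i < n + n + (n + n)) u i.+1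
  = \prod_(i < n) u (4 * i + 1)%N * \prod_(i < n) u (4 * i + 2)%N
    * \prod_(i < n) u (4 * i + 3)%N * \prod_(i < n) u (4 * i + 4)%N.
Proof.
rewrite (@big_even_odd _ _ *%R (fun i => u i.+1)).
rewrite (@big_even_odd _ _ *%R (fun i => u (i + i).+1)).
rewrite (@big_even_odd _ _ *%R (fun i => u (i + i).+2)) /=.
rewrite mulrACA !mulrA.
by congr (_ * _ * _ * _); apply: eq_bigr => i _; congr u; lia.
Qed.

(** * Infinite products and the triple product *)

Section InfiniteProducts.

Variables (F : fieldType) (M : nat).
Implicit Types q : {poly F}.

Local Notation "p ~ q" := (congX M p q) (at level 70).

(** The first M factors of three infinite products: the Euler products of the
1 - q^n and of the 1 + q^n, and the part of the latter with n odd. *)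
Definition euler q := qpoch q M.
Definition euler_plus q := \prod_(i < M) (1 + q ^+ i.+1).
Definition odd_plus q := \prod_(i < M) (1 + q ^+ (1 + 2 * i)).

Lemma horner0_dvdX q : 'X %| q -> q.[0] = 0.
Proof. by move=> qX; apply/rootP; rewrite -dvdp_XsubCl polyC0 subr0. Qed.

Lemma qpoch_at0 q n : 'X %| q -> (qpoch q n).[0] = 1.
Proof.
move=> qX; rewrite /qpoch horner_prod big1 // => i _.
by rewrite !hornerE horner0_dvdX // expr0n subr0.
Qed.

Lemma qpoch_trunc q n : 'X %| q -> (M <= n)%N -> qpoch q n ~ euler q.
Proof.
move=> qX leMn; apply: (@prod_congX_trunc F M (fun i => 1 - q ^+ i.+1)) => //.
by move=> i leMi; rewrite congX_exp0 ?subr0 // ltnW.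
Qed.

Lemma congX_cancel_euler q p r : 'X %| q -> euler q * p ~ euler q * r -> p ~ r.
Proof. by move=> qX; apply: congX_cancel; rewrite qpoch_at0 // oner_neq0. Qed.

(** Far from both ends, [gbinom_qpoch] reads gbinom * E * E = E with E the
Euler product. *)
Lemma gbinom_limit q n k : 'X %| q -> (M <= k)%N -> (M <= n - k)%N ->
  gbinom q n k * euler q ~ 1.
Proof.
move=> qX leMk leMnk; apply: (congX_cancel_euler qX).
have [lekn | ltnk] := leqP k n; last first.
  have M0 : M = 0%N by lia.
  by rewrite M0; apply/congXP; rewrite expr0 dvd1p.
have := gbinom_qpoch q lekn; have leMn := leq_trans leMk lekn.
move=> h; rewrite mulr1 -{3}(qpoch_trunc qX leMn) -h.
rewrite !qpoch_trunc //; apply: congX_eq; ring.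
Qed.

(** The Jacobi triple product at a power of q. The hypothesis 0 < a makes the
j-th exponent at least j in both sums, so that the terms beyond M vanish. *)
Lemma jacobi_triple q a b : 'X %| q -> q != 0 -> (0 < a)%N ->
  let d := (a + b)%N in
  \prod_(i < M) ((1 + q ^+ (a + d * i)) * (1 + q ^+ (b + d * i)))
    * euler (q ^+ d)
  ~ \sum_(j < M) q ^+ (d * 'C(j, 2) + a * j)
    + \sum_(j < M) q ^+ (d * 'C(j.+1, 2) + b * j.+1).
Proof.
move=> qX q0 a0 d; have d0 : (0 < d)%N by rewrite addn_gt0 a0.
have qdX : 'X %| q ^+ d by rewrite -(prednK d0) exprS dvdp_mulr.
have leM2 : (M <= M + M)%N by apply: leq_addr.
rewrite -(prod_congX_trunc (u := fun i =>
  (1 + q ^+ (a + d * i)) * (1 + q ^+ (b + d * i))) leM2); last first.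
  move=> i leMi /=.
  have leMdi : (M <= d * i)%N by apply: leq_trans (leq_pmull _ d0).
  rewrite (congX_exp0 qX (n := a + _)) ?(leq_trans leMdi (leq_addl _ _)) //.
  rewrite (congX_exp0 qX (n := b + _)) ?(leq_trans leMdi (leq_addl _ _)) //.
  by rewrite addr0 mulr1.
(* With 2M factors of each kind, every Gaussian binomial coefficient attached
   to a j < M is at distance at least M from both ends, hence in its limit. *)
have := finite_jacobi_triple a b (M + M) q0; rewrite /= -/d => ->.
have e1 j : (j <= d * 'C(j, 2) + a * j)%N.
  by apply: leq_trans (leq_addl _ _); apply: leq_pmull.
have e2 j : (j <= d * 'C(j.+1, 2) + b * j.+1)%N.
  rewrite binS bin1 mulnDr -addnA addnCA.
  by apply: leq_trans (leq_addr _ _); apply: leq_pmull.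
have S1 := @sum_congX_trunc F M (fun j =>
  gbinom (q ^+ d) (M + M + (M + M)) (M + M + j) * q ^+ (d * 'C(j, 2) + a * j))
  (M + M).+1.
have S2 := @sum_congX_trunc F M (fun j =>
  gbinom (q ^+ d) (M + M + (M + M)) (M + M - j.+1)
  * q ^+ (d * 'C(j.+1, 2) + b * j.+1)) (M + M).
rewrite S1; first last.
- by move=> j leMj; apply: congX_mul_exp0 => //; apply: leq_trans leMj _.
- exact: leqW.
rewrite S2; first last.
- by move=> j leMj; apply: congX_mul_exp0 => //; apply: leq_trans leMj _.
- by [].
rewrite mulrDl !mulr_suml; apply: congX_add; apply: congX_sum => j;
  by rewrite mulrAC gbinom_limit ?mul1r //; have := ltn_ord j; lia.
Qed.

Lemma euler_double q : euler_plus q * euler q = euler (q ^+ 2).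
Proof.
rewrite /euler_plus /euler /qpoch -big_split; apply: eq_bigr => i _ /=.
by rewrite -exprM mulnC exprM; ring.
Qed.

Lemma euler_plus_odd_even q : 'X %| q ->
  euler_plus q ~ odd_plus q * euler_plus (q ^+ 2).
Proof.
move=> qX; have leM2 : (M <= M + M)%N by apply: leq_addr.
have -> : euler_plus q ~ \prod_(i < M + M) (1 + q ^+ i.+1).
  symmetry; apply: (prod_congX_trunc (u := fun i => 1 + q ^+ i.+1)) => // i.
  by move=> leMi; rewrite congX_exp0 ?addr0 // leqW.
rewrite (@big_even_odd _ _ *%R (fun i => 1 + q ^+ i.+1)).
apply: congX_mul; apply: congX_prod => i.
  by rewrite add1n mul2n addnn.
by rewrite -exprM mul2n doubleS addnn.
Qed.

Lemma euler_opp q : 'X %| q -> euler (- q) ~ odd_plus q * euler (q ^+ 2).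
Proof.
move=> qX; have leM2 : (M <= M + M)%N by apply: leq_addr.
rewrite -(qpoch_trunc _ leM2) ?dvdpNr //.
rewrite /qpoch (@big_even_odd _ _ *%R (fun i => 1 - (- q) ^+ i.+1)).
apply: congX_mul; apply: congX_prod => i.
  rewrite add1n mul2n addnn exprNn -signr_odd /= odd_double expr1 mulN1r opprK.
  reflexivity.
rewrite -exprM mul2n doubleS addnn exprNn -signr_odd /= odd_double mul1r.
reflexivity.
Qed.

End InfiniteProducts.

(** * Ramanujan's theta functions *)

Section Theta.

Variables (F : numFieldType) (M : nat).
Implicit Types q : {poly F}.

Local Notation "p ~ q" := (congX M p q) (at level 70).
Local Notation euler := (euler M).
Local Notation euler_plus := (euler_plus M).
Local Notation odd_plus := (odd_plus M).

(** Ramanujan's phi and psi. *)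
Definition Phi q := 1 + 2 * \sum_(j < M) q ^+ (j.+1 ^ 2).
Definition Psi q := \sum_(j < M) q ^+ 'C(j.+1, 2).

Lemma dvdX_exp q n : 'X %| q -> (0 < n)%N -> 'X %| q ^+ n.
Proof. by move=> qX n0; rewrite -(prednK n0) exprS dvdp_mulr. Qed.

Lemma euler_at0 q : 'X %| q -> (euler q).[0] = 1.
Proof. exact: qpoch_at0. Qed.

(** The triple product with a = b = 1. Its two sums give the squares of all
j >= 0 and of all j >= 1. *)
Lemma Phi_prod q : 'X %| q -> q != 0 ->
  Phi q ~ odd_plus q ^+ 2 * euler (q ^+ 2).
Proof.
move=> qX q0; have := @jacobi_triple _ M q 1 1 qX q0 isT => /=.
rewrite big_split /= -/(odd_plus q) expr2 => ->.
have -> : \sum_(j < M) q ^+ (2 * 'C(j, 2) + 1 * j)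
        ~ \sum_(j < M.+1) q ^+ (j ^ 2).
  symmetry.
  rewrite (sum_congX_trunc (u := fun j => q ^+ (j ^ 2))) //.
    apply: congX_sum => j; rewrite (_ : _ + _ = j ^ 2)%N //.
    by case: (nat_of_ord j) => // n; rewrite -(mul_bin_diag n.+1 1) bin1; lia.
  by move=> j leMj; apply: congX_exp0 => //; nia.
have -> : \sum_(j < M) q ^+ (2 * 'C(j.+1, 2) + 1 * j.+1)
        = \sum_(j < M) q ^+ (j.+1 ^ 2).
  apply: eq_bigr => j _; congr (_ ^+ _).
  by rewrite -(mul_bin_diag j.+1 1) bin1; lia.
by rewrite big_ord_recl /= expr0 /Phi mulr2n mulrDl mul1r addrA.
Qed.

(** Splitting the factors 1 + q^n by the parity of n, and writing them as
quotients of Euler products. *)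
Lemma odd_plus_euler q : 'X %| q ->
  odd_plus q * (euler q * euler (q ^+ 4)) ~ euler (q ^+ 2) ^+ 2.
Proof.
move=> qX; rewrite [q ^+ 4](exprM q 2 2) -[euler (_ ^+ 2 ^+ 2)]euler_double.
have -> : odd_plus q * (euler q * (euler_plus (q ^+ 2) * euler (q ^+ 2)))
        = odd_plus q * euler_plus (q ^+ 2) * euler q * euler (q ^+ 2) by ring.
by rewrite -euler_plus_odd_even // euler_double expr2.
Qed.

Lemma Phi_euler q : 'X %| q -> q != 0 ->
  Phi q * (euler q ^+ 2 * euler (q ^+ 4) ^+ 2) ~ euler (q ^+ 2) ^+ 5.
Proof.
move=> qX q0; rewrite Phi_prod //.
have -> : odd_plus q ^+ 2 * euler (q ^+ 2)
          * (euler q ^+ 2 * euler (q ^+ 4) ^+ 2)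
        = (odd_plus q * (euler q * euler (q ^+ 4))) ^+ 2 * euler (q ^+ 2).
  by ring.
by rewrite odd_plus_euler // -exprM -exprSr.
Qed.

Lemma euler_opp_prod q : 'X %| q ->
  euler (- q) * (euler q * euler (q ^+ 4)) ~ euler (q ^+ 2) ^+ 3.
Proof.
by move=> qX; rewrite euler_opp // mulrAC odd_plus_euler // -exprSr.
Qed.

(** [Phi_euler] at - q, where [euler_opp_prod] expresses euler (- q) by Euler
products at powers of q. *)
Lemma Phi_opp_euler q : 'X %| q -> q != 0 ->
  Phi (- q) * euler (q ^+ 2) ~ euler q ^+ 2.
Proof.
move=> qX q0; have q2X := dvdX_exp (n := 2) qX isT.
have := @Phi_euler (- q); rewrite dvdpNr oppr_eq0 => /(_ qX q0).
rewrite sqrrN (_ : (- q) ^+ 4 = q ^+ 4); last by ring.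
move=> h; apply: (congX_cancel (p := euler (q ^+ 2) ^+ 5)).
  by rewrite horner_exp euler_at0 // expr1n oner_neq0.
have -> : euler (q ^+ 2) ^+ 5 * (Phi (- q) * euler (q ^+ 2))
        = Phi (- q) * (euler (q ^+ 2) ^+ 3) ^+ 2 by ring.
rewrite -euler_opp_prod // -h.
set x := Phi _; set y := euler _; set z := euler q; set t := euler _.
by rewrite (_ : x * _ = x * (y ^+ 2 * t ^+ 2) * z ^+ 2) //; ring.
Qed.

(** The triple product with a = 1 and b = 0. Both of its sums are the series of
psi, and the factor i = 0 in b is 2: this common 2 is cancelled. *)
Lemma Psi_euler q : 'X %| q -> q != 0 ->
  Psi q * euler q ~ euler (q ^+ 2) ^+ 2.
Proof.
move=> qX q0; have := @jacobi_triple _ M q 1 0 qX q0 isT => /=.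
rewrite big_split /= expr1.
have -> : \prod_(i < M) (1 + q ^+ (1 + 1 * i)) = euler_plus q.
  by apply: eq_bigr => i _; rewrite mul1n add1n.
have -> : \prod_(i < M) (1 + q ^+ (0 + 1 * i)) ~ 2 * euler_plus q.
  rewrite (eq_bigr (fun i : 'I_M => 1 + q ^+ i)); last first.
    by move=> i _; rewrite mul1n add0n.
  rewrite -(prod_congX_trunc (n := M.+1) (u := fun i => 1 + q ^+ i)) //.
    by rewrite big_ord_recl /= expr0.
  by move=> i leMi; rewrite congX_exp0 // addr0.
have -> : \sum_(j < M) q ^+ (1 * 'C(j, 2) + 1 * j) = Psi q.
  by apply: eq_bigr => j _; rewrite !mul1n binS bin1.
have -> : \sum_(j < M) q ^+ (1 * 'C(j.+1, 2) + 0 * j.+1) = Psi q.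
  by apply: eq_bigr => j _; rewrite mul1n addn0.
move=> h; apply: (congX_cancel (p := 2%:P)).
  by rewrite hornerC pnatr_eq0.
have -> : 2%:P * (Psi q * euler q) = (Psi q + Psi q) * euler q.
  by rewrite polyCMn polyC1; ring.
rewrite -h -euler_double polyCMn polyC1.
by apply: congX_eq; ring.
Qed.

Lemma Phi_Psi q : 'X %| q -> q != 0 -> Phi q * Psi (q ^+ 2) ~ Psi q ^+ 2.
Proof.
move=> qX q0; have q2X := dvdX_exp (n := 2) qX isT.
have q4X := dvdX_exp (n := 4) qX isT.
have q20 : q ^+ 2 != 0 by rewrite expf_neq0.
have h2 := Psi_euler q2X q20; rewrite -exprM in h2.
apply: (congX_cancel
  (p := euler q ^+ 2 * euler (q ^+ 4) ^+ 2 * euler (q ^+ 2))).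
  by rewrite hornerM hornerM !horner_exp !euler_at0 // !expr1n !mulr1 oner_neq0.
transitivity (Phi q * (euler q ^+ 2 * euler (q ^+ 4) ^+ 2)
              * (Psi (q ^+ 2) * euler (q ^+ 2))).
  by apply: congX_eq; ring.
rewrite Phi_euler // h2.
transitivity ((Psi q * euler q) ^+ 2 * (euler (q ^+ 4) ^+ 2 * euler (q ^+ 2))).
  rewrite Psi_euler //.
  by apply: congX_eq; ring.
by apply: congX_eq; ring.
Qed.

Lemma Phi_mul_opp q : 'X %| q -> q != 0 ->
  Phi q * Phi (- q) ~ Phi (- q ^+ 2) ^+ 2.
Proof.
move=> qX q0; have q2X := dvdX_exp (n := 2) qX isT.
have q4X := dvdX_exp (n := 4) qX isT.
have q20 : q ^+ 2 != 0 by rewrite expf_neq0.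
have h2 := Phi_opp_euler q2X q20; rewrite -exprM in h2.
apply: (congX_cancel
  (p := euler q ^+ 2 * euler (q ^+ 4) ^+ 2 * euler (q ^+ 2))).
  by rewrite hornerM hornerM !horner_exp !euler_at0 // !expr1n !mulr1 oner_neq0.
transitivity (Phi q * (euler q ^+ 2 * euler (q ^+ 4) ^+ 2)
              * (Phi (- q) * euler (q ^+ 2))).
  by apply: congX_eq; ring.
rewrite Phi_euler // Phi_opp_euler //.
transitivity ((Phi (- q ^+ 2) * euler (q ^+ 4)) ^+ 2
              * (euler q ^+ 2 * euler (q ^+ 2))).
  rewrite h2.
  by apply: congX_eq; ring.
by apply: congX_eq; ring.
Qed.

(** Squares of even numbers are 4 * j^2, squares of odd numbers are 8 times a
triangular number plus 1. *)
Lemma Phi_dissection q : 'X %| q ->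
  Phi q ~ Phi (q ^+ 4) + 2 * q * Psi (q ^+ 8).
Proof.
move=> qX; have leM2 : (M <= M + M)%N by apply: leq_addr.
rewrite {1}/Phi -(sum_congX_trunc (u := fun j => q ^+ (j.+1 ^ 2)) leM2);
  last first.
  by move=> j leMj; apply: congX_exp0 => //; nia.
rewrite (@big_even_odd _ _ +%R (fun j => q ^+ (j.+1 ^ 2))) /= /Phi.
have -> : \sum_(i < M) q ^+ ((i + i).+1 ^ 2) = q * Psi (q ^+ 8).
  rewrite /Psi mulr_sumr; apply: eq_bigr => i _; rewrite -exprM -exprS.
  by congr (_ ^+ _); have := mul_bin_diag i.+1 1; rewrite bin1 /=; nia.
have -> : \sum_(i < M) q ^+ ((i + i).+2 ^ 2)
        = \sum_(i < M) (q ^+ 4) ^+ (i.+1 ^ 2).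
  by apply: eq_bigr => i _; rewrite -exprM; congr (_ ^+ _); nia.
by apply: congX_eq; ring.
Qed.

Lemma Phi_add_opp q : 'X %| q -> Phi q + Phi (- q) ~ 2 * Phi (q ^+ 4).
Proof.
move=> qX; rewrite {1}Phi_dissection // {1}(@Phi_dissection (- q)) ?dvdpNr //.
rewrite (_ : (- q) ^+ 4 = q ^+ 4); last by ring.
rewrite (_ : (- q) ^+ 8 = q ^+ 8); last by ring.
by apply: congX_eq; ring.
Qed.

Lemma Phi_sub_opp q : 'X %| q -> Phi q - Phi (- q) ~ 4 * q * Psi (q ^+ 8).
Proof.
move=> qX; rewrite {1}Phi_dissection // {1}(@Phi_dissection (- q)) ?dvdpNr //.
rewrite (_ : (- q) ^+ 4 = q ^+ 4); last by ring.
rewrite (_ : (- q) ^+ 8 = q ^+ 8); last by ring.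
by apply: congX_eq; ring.
Qed.

Definition phi_defect q := Phi q ^+ 2 + Phi (- q) ^+ 2 - 2 * Phi (q ^+ 2) ^+ 2.

(** The sum of squares is (phi(q) + phi(-q))^2 - 2 phi(q) phi(-q), and both
terms are values of phi at - q^2 and q^4 by [Phi_add_opp] and [Phi_mul_opp]. *)
Lemma phi_defect_double q : 'X %| q -> q != 0 ->
  phi_defect q ~ (- 2) * phi_defect (q ^+ 2).
Proof.
move=> qX q0; transitivity
  ((Phi q + Phi (- q)) ^+ 2 - 2 * (Phi q * Phi (- q)) - 2 * Phi (q ^+ 2) ^+ 2).
  by apply: congX_eq; rewrite /phi_defect; ring.
rewrite Phi_add_opp // Phi_mul_opp // /phi_defect -exprM.
by apply: congX_eq; ring.
Qed.

Lemma euler_comp q r : euler q \Po r = euler (q \Po r).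
Proof.
rewrite /euler /qpoch rmorph_prod; apply: eq_bigr => i _.
by rewrite rmorphB rmorph1 rmorphXn.
Qed.

Lemma Phi_comp q r : Phi q \Po r = Phi (q \Po r).
Proof.
rewrite /Phi rmorphD rmorph1 rmorphM rmorph_nat rmorph_sum.
by congr (1 + 2 * _); apply: eq_bigr => i _; rewrite rmorphXn.
Qed.

Lemma Phi_at0 q : 'X %| q -> (Phi q).[0] = 1.
Proof.
move=> qX; rewrite /Phi !hornerE horner_sum big1 ?mulr0 ?addr0 // => i _.
by rewrite horner_exp horner0_dvdX // expr0n.
Qed.

Lemma Phi_sq_add : let q : {poly F} := 'X in
  Phi q ^+ 2 + Phi (- q) ^+ 2 ~ 2 * Phi (q ^+ 2) ^+ 2.
Proof.
move=> q; have qX : 'X %| q by [].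
have D0 : phi_defect q ~ 0.
  apply: (congX_descent (c := - 2)).
    rewrite -horner_coef0 /phi_defect; have nqX : 'X %| - q by rewrite dvdpNr.
    have q2X : 'X %| q ^+ 2 by apply: dvdX_exp.
    move: (Phi_at0 qX) (Phi_at0 nqX) (Phi_at0 q2X).
    move: (Phi q) (Phi (- q)) (Phi (q ^+ 2)) => f g h f0 g0 h0.
    by rewrite !hornerE f0 g0 h0 /=; ring.
  transitivity (- 2 * phi_defect (q ^+ 2)).
    by apply: phi_defect_double; rewrite ?polyX_eq0.
  apply: congX_eq.
  rewrite polyCN polyCMn polyC1; congr (_ * _).
  have compD (f g h r : {poly F}) : (f ^+ 2 + g ^+ 2 - 2 * h ^+ 2) \Po r
      = (f \Po r) ^+ 2 + (g \Po r) ^+ 2 - 2 * (h \Po r) ^+ 2.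
    rewrite !expr2 comp_polyB comp_polyD !comp_polyM.
    by rewrite (rmorph_nat (comp_poly r) 2).
  rewrite /phi_defect compD !Phi_comp rmorphN /= rmorphXn /= comp_polyX.
  by [].
rewrite -[X in _ ~ X]add0r -D0; apply: congX_eq; rewrite /phi_defect; ring.
Qed.

(** * Jacobi's aequatio identica satis abstrusa *)

Lemma jacobi_abstruse : let q : {poly F} := 'X in
  euler (q ^+ 2) ^+ 24 ~
  euler q ^+ 16 * euler (q ^+ 4) ^+ 8
  + 16 * q * euler q ^+ 8 * euler (q ^+ 4) ^+ 16.
Proof.
move=> q; have qX : 'X %| q by [].
have q0 : q != 0 by rewrite polyX_eq0.
have q2X := dvdX_exp (n := 2) qX isT; have q4X := dvdX_exp (n := 4) qX isT.
have q20 : q ^+ 2 != 0 by rewrite expf_neq0.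
have q40 : q ^+ 4 != 0 by rewrite expf_neq0.
(* In terms of theta functions: phi(q)^4 - phi(-q)^4 = 16 q psi(q^2)^4. *)
have J : Phi q ^+ 4 - Phi (- q) ^+ 4 ~ 16 * q * Psi (q ^+ 2) ^+ 4.
  transitivity ((Phi q ^+ 2 + Phi (- q) ^+ 2)
                * ((Phi q + Phi (- q)) * (Phi q - Phi (- q)))).
    by apply: congX_eq; ring.
  rewrite Phi_sq_add Phi_add_opp // Phi_sub_opp //.
  have h4 := Phi_Psi q4X q40; rewrite -exprM in h4.
  have h2 := Phi_Psi q2X q20; rewrite -exprM in h2.
  transitivity (16 * q * Phi (q ^+ 2) ^+ 2 * (Phi (q ^+ 4) * Psi (q ^+ 8))).
    by apply: congX_eq; ring.
  rewrite h4.
  transitivity (16 * q * (Phi (q ^+ 2) * Psi (q ^+ 4)) ^+ 2).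
    by apply: congX_eq; ring.
  by rewrite h2; apply: congX_eq; ring.
have e1 := Phi_euler qX q0.
have e2 := Phi_opp_euler qX q0.
have e3 := Psi_euler q2X q20; rewrite -exprM in e3.
set x := euler q in e1 e2 e3 J *; set y := euler (q ^+ 2) in e1 e2 e3 J *.
set z := euler (q ^+ 4) in e1 e2 e3 J *.
transitivity ((Phi q * (x ^+ 2 * z ^+ 2)) ^+ 4 * y ^+ 4).
  by rewrite e1; apply: congX_eq; ring.
transitivity ((Phi (- q) * y) ^+ 4 * x ^+ 8 * z ^+ 8
              + 16 * q * (Psi (q ^+ 2) * y) ^+ 4 * x ^+ 8 * z ^+ 8).
  transitivity ((16 * q * Psi (q ^+ 2) ^+ 4 + Phi (- q) ^+ 4)
                * (x ^+ 8 * y ^+ 4 * z ^+ 8)).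
    by rewrite -J; apply: congX_eq; ring.
  by apply: congX_eq; ring.
by rewrite e2 e3; apply: congX_eq; ring.
Qed.

Lemma jacobi_abstruse_sq : let q : {poly F} := 'X in
  euler (q ^+ 4) ^+ 24 ~
  euler (q ^+ 2) ^+ 16 * euler (q ^+ 8) ^+ 8
  + 16 * q ^+ 2 * euler (q ^+ 2) ^+ 8 * euler (q ^+ 8) ^+ 16.
Proof.
move=> q; have q2X : 'X %| q ^+ 2 by apply: dvdX_exp.
have := congX_comp q2X jacobi_abstruse.
have compD (x y r : {poly F}) :
    (x ^+ 16 * y ^+ 8 + 16 * q * x ^+ 8 * y ^+ 16) \Po r
  = (x \Po r) ^+ 16 * (y \Po r) ^+ 8
    + 16 * (q \Po r) * (x \Po r) ^+ 8 * (y \Po r) ^+ 16.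
  rewrite comp_polyD; congr (_ + _); first by rewrite comp_polyM !rmorphXn.
  by rewrite 3!comp_polyM !rmorphXn (rmorph_nat (comp_poly r) 16).
by rewrite compD rmorphXn /= !euler_comp !rmorphXn /= comp_polyX -!exprM.
Qed.

(** * The eighth power identity *)

Definition prod_mod (e : F) (r : nat) : {poly F} :=
  \prod_(i < M) (1 + e *: 'X^(4 * i + r)).

Lemma prod_mod4 (e : F) :
  \prod_(i < M + M + (M + M)) (1 + e *: 'X^(i.+1))
  = prod_mod e 1 * prod_mod e 2 * prod_mod e 3 * prod_mod e 4.
Proof. exact: (big_mod4 (fun n => 1 + e *: 'X^n)). Qed.

Lemma euler_plus_mod4 : let q : {poly F} := 'X in
  euler_plus q ~ prod_mod 1 1 * prod_mod 1 2 * prod_mod 1 3 * prod_mod 1 4.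
Proof.
move=> q; rewrite -prod_mod4; symmetry.
rewrite (@prod_congX_trunc F M (fun i => 1 + 1 *: 'X^(i.+1))); first last.
- by move=> i leMi; rewrite scale1r congX_exp0 ?addr0 // leqW.
- by lia.
by apply: congX_prod => i; rewrite scale1r.
Qed.

Lemma euler_mod4 : let q : {poly F} := 'X in
  euler q
  ~ prod_mod (-1) 1 * prod_mod (-1) 2 * prod_mod (-1) 3 * prod_mod (-1) 4.
Proof.
move=> q; rewrite -prod_mod4; symmetry.
rewrite (@prod_congX_trunc F M (fun i => 1 + -1 *: 'X^(i.+1))); first last.
- by move=> i leMi; rewrite scaleN1r congX_exp0 ?subr0 // leqW.
- by lia.
by apply: congX_prod => i; rewrite scaleN1r.
Qed.

Lemma euler_plus4_mod4 : let q : {poly F} := 'X in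
  euler_plus (q ^+ 4) = prod_mod 1 4.
Proof.
by move=> q; apply: eq_bigr => i _; rewrite scale1r -exprM mulnSr.
Qed.

Lemma euler4_mod4 : let q : {poly F} := 'X in
  euler (q ^+ 4) = prod_mod (-1) 4.
Proof.
by move=> q; apply: eq_bigr => i _; rewrite scaleN1r -exprM mulnSr.
Qed.

Lemma euler_plus2_mod4 : let q : {poly F} := 'X in
  euler_plus (q ^+ 2) ~ prod_mod 1 2 * prod_mod 1 4.
Proof.
move=> q; have q2X : 'X %| q ^+ 2 by apply: dvdX_exp.
transitivity (\prod_(i < M + M) (1 + (q ^+ 2) ^+ i.+1)).
  symmetry; apply: (@prod_congX_trunc F M (fun i => 1 + (q ^+ 2) ^+ i.+1)).
    exact: leq_addr.
  by move=> i leMi; rewrite congX_exp0 ?addr0 // leqW.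
rewrite (@big_even_odd _ _ *%R (fun i => 1 + (q ^+ 2) ^+ i.+1)) /=.
apply: congX_eq; congr (_ * _); apply: eq_bigr => i _;
  by rewrite scale1r -exprM; congr (1 + q ^+ _); lia.
Qed.

Lemma eight_power_identity : let q : {poly F} := 'X in
  (prod_mod 1 1 * prod_mod 1 2 * prod_mod 1 3) ^+ 8
  - (prod_mod (-1) 1 * prod_mod (-1) 2 * prod_mod (-1) 3) ^+ 8
  ~ 16 * q
    + 16 * q ^+ 2 * (prod_mod 1 1 * prod_mod 1 3 * prod_mod 1 4) ^+ 8.
Proof.
move=> q; have qX : 'X %| q by [].
have qnX n : (0 < n)%N -> 'X %| q ^+ n by apply: dvdX_exp.
set A := prod_mod 1 1 * _ * _; set B := prod_mod (-1) 1 * _ * _.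
set C := prod_mod 1 1 * _ * _.
have J1 := jacobi_abstruse; have J2 := jacobi_abstruse_sq.
rewrite /= -/q in J1 J2.
have d1 : euler (q ^+ 2) = euler_plus q * euler q by rewrite euler_double.
have d2 : euler (q ^+ 4) = euler_plus (q ^+ 2) * euler (q ^+ 2).
  by rewrite euler_double -exprM.
have d4 : euler (q ^+ 8) = euler_plus (q ^+ 4) * euler (q ^+ 4).
  by rewrite euler_double -exprM.
have hA : A * (euler q * euler (q ^+ 8)) ~ euler (q ^+ 2) * euler (q ^+ 4).
  rewrite d4 d1 euler_plus_mod4 -/q euler_plus4_mod4.
  by apply: congX_eq; rewrite /A; ring.
have hB : B * euler (q ^+ 4) ~ euler q by rewrite euler_mod4 euler4_mod4.
have hC : C * (euler q * euler (q ^+ 4) ^+ 2)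
          ~ euler (q ^+ 2) ^+ 2 * euler (q ^+ 8).
  transitivity (C * euler_plus (q ^+ 2)
                * (euler q * euler (q ^+ 2) * euler (q ^+ 4))).
    by apply: congX_eq; rewrite d2; ring.
  transitivity (euler_plus q * euler_plus (q ^+ 4)
                * (euler q * euler (q ^+ 2) * euler (q ^+ 4))).
    rewrite euler_plus_mod4 euler_plus2_mod4 euler_plus4_mod4.
    by apply: congX_eq; rewrite /C; ring.
  by apply: congX_eq; rewrite d4 d1; ring.
have e1 := euler_at0 qX; have e2 := euler_at0 (qnX 2%N isT).
have e4 := euler_at0 (qnX 4%N isT); have e8 := euler_at0 (qnX 8%N isT).
(* From here on x, y, z, t stand for E_1, E_2, E_4, E_8, and the identity is
   multiplied by the denominators x^8 t^8 z^16. *)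
clear d1 d2 d4; move: J1 J2 hA hB hC e1 e2 e4 e8.
move: (euler q) (euler (q ^+ 2)) (euler (q ^+ 4)) (euler (q ^+ 8)) => x y z t.
move: A B C => A B C J1 J2 hA hB hC x0 y0 z0 t0.
apply: (congX_cancel (p := x ^+ 8 * t ^+ 8 * z ^+ 16)).
  by rewrite !hornerE x0 z0 t0 /= ?expr1n ?mulr1 oner_neq0.
transitivity ((A * (x * t)) ^+ 8 * z ^+ 16
              - (B * z) ^+ 8 * x ^+ 8 * t ^+ 8 * z ^+ 8).
  by apply: congX_eq; ring.
transitivity (16 * q * (x ^+ 8 * t ^+ 8 * z ^+ 16)
  + 16 * q ^+ 2 * (C * (x * z ^+ 2)) ^+ 8 * t ^+ 8); last first.
  by apply: congX_eq; ring.
rewrite hA hB hC.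
transitivity (y ^+ 8 * z ^+ 24 - x ^+ 16 * z ^+ 8 * t ^+ 8).
  by apply: congX_eq; ring.
rewrite J2.
transitivity (y ^+ 24 * t ^+ 8 + 16 * q ^+ 2 * y ^+ 16 * t ^+ 16
              - x ^+ 16 * z ^+ 8 * t ^+ 8).
  by apply: congX_eq; ring.
rewrite J1.
by apply: congX_eq; ring.
Qed.

End Theta.

Local Close Scope ring_scope.

(** * Generating functions of partitions into colored parts *)

Section Counting.

Variables (k K : nat) (P : pred nat).

Local Notation color := ('I_K * 'I_k)%type.

(** Parts of size below K form a finite type, so that partitions become sets
over it and a product over all parts can be expanded. *)
Definition uncolor (c : color) : colored k := (val c.1, c.2).

Lemma uncolor_inj : injective uncolor.
Proof. by move=> [i a] [j b] [/val_inj -> ->]. Qed.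

Definition fset_of (J : {set color}) : {fset colored k} :=
  seq_fset tt [seq uncolor c | c <- enum J].

Lemma mem_fset_of (J : {set color}) (c : color) :
  (uncolor c \in fset_of J) = (c \in J).
Proof. by rewrite seq_fsetE mem_map ?mem_enum //; apply: uncolor_inj. Qed.

Lemma fset_of_inj : injective fset_of.
Proof.
by move=> J1 J2 eqJ; apply/setP=> c; rewrite -!mem_fset_of eqJ.
Qed.

Lemma perm_fset_of (J : {set color}) :
  perm_eq (fset_of J) [seq uncolor c | c <- enum J].
Proof.
rewrite (perm_trans (seq_fset_perm _ _)) // undup_id //.
by rewrite map_inj_uniq ?enum_uniq //; apply: uncolor_inj.
Qed.

Lemma card_fset_of (J : {set color}) : #|` fset_of J| = #|J|.
Proof. by rewrite (perm_size (perm_fset_of J)) size_map cardE. Qed.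

Lemma sum_fset_of (J : {set color}) :
  (\sum_(c <- fset_of J) c.1) = \sum_(c in J) c.1.
Proof.
by rewrite (perm_big _ (perm_fset_of J)) big_map big_enum.
Qed.

Definition bounded_partitions (N : nat) (Q : pred nat) : {set {set color}} :=
  [set J : {set color} | [&& [forall c in J, P c.1],
     \sum_(c in J) c.1 == N & Q #|J|]].

(** Every part of a partition of N is at most N, so for N < K the bound K
excludes no partition. *)
Lemma num_partitions (N : nat) (Q : pred nat) (S : set nat) :
    N < K -> (forall n, S n <-> P n) ->
  num_elements (partitions (copies k S) N
                `&` [set A : {fset colored k} | Q #|` A|])%classic
  = #|bounded_partitions N Q|.
Proof.
move=> ltNK SP; rewrite /num_elements.
set X := (X in fset_set X).
pose B := seq_fset tt [seq fset_of J | J <- enum (bounded_partitions N Q)].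
have -> : X = [set` B]%classic.
  apply/seteqP; split=> A.
    move=> [[AS AN] AQ] /=; rewrite seq_fsetE.
    pose J : {set color} := [set c | uncolor c \in A].
    have eqA : A = fset_of J.
      apply/fsetP=> -[n a].
      have [ltnK | leKn] := ltnP n K.
        by rewrite (mem_fset_of J (Ordinal ltnK, a)) inE.
      rewrite seq_fsetE; apply/idP/mapP => [nA | [c _ [] eqn]].
        move: AN leKn; rewrite (big_rem (n, a)) //=; lia.
      by move: leKn; rewrite eqn leqNgt ltn_ord.
    apply/mapP; exists J; rewrite // mem_enum inE; apply/and3P; split.
    - by apply/forall_inP => c; rewrite inE => /AS /SP.
    - by rewrite -sum_fset_of -eqA AN.
    - by rewrite -card_fset_of -eqA.
  rewrite /= seq_fsetE => /mapP[J]; rewrite mem_enum inE.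
  move=> /and3P[JP /eqP JN JQ] ->.
  split; last by rewrite /= card_fset_of.
  split; last by rewrite sum_fset_of.
  move=> c /=; rewrite seq_fsetE => /mapP[d]; rewrite mem_enum => dJ ->.
  by apply/SP; apply: (forall_inP JP).
rewrite set_fsetK (perm_size (seq_fset_perm _ _)) undup_id ?size_map -?cardE //.
by rewrite map_inj_uniq ?enum_uniq //; apply: fset_of_inj.
Qed.

Local Open Scope ring_scope.

(** Expanding the product over all colored parts chooses the set J of parts that
contribute e *: 'X^n; a set containing a part outside P contributes 0. *)
Lemma genfun_partitions (R : comNzRingType) (e : R) :
  \prod_(n < K | P n) (1 + e *: 'X^n) ^+ k
  = \sum_(J : {set color} | [forall c in J, P c.1])
      e ^+ #|J| *: 'X^(\sum_(c in J) c.1).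
Proof.
transitivity (\prod_(c : color) ((if P c.1 then e *: 'X^(c.1) else 0) + 1)).
  rewrite -(pair_bigA _ (fun (n : 'I_K) (a : 'I_k) =>
    (if P n then e *: 'X^n else 0) + 1)) big_mkcond /=.
  apply: eq_bigr => n _; rewrite prodr_const card_ord.
  by case: ifP => _; rewrite ?add0r ?expr1n // addrC.
rewrite bigA_distr [RHS]big_mkcond /=; apply: eq_bigr => J _.
rewrite -big_mkcond /=.
case: ifP => [/forall_inP JP | /forall_inPn[c cJ /negbTE Pc]].
  rewrite (eq_bigr (fun c : color => e *: 'X^(c.1))); last by move=> c /JP ->.
  by rewrite scaler_prod prodr_const expr_sum.
by rewrite (bigD1 c) //= Pc mul0r.
Qed.

Lemma coef_genfun (R : comNzRingType) (e : R) (N : nat) :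
  (\prod_(n < K | P n) (1 + e *: 'X^n) ^+ k)`_N
  = \sum_(J in bounded_partitions N xpredT) e ^+ #|J|.
Proof.
rewrite genfun_partitions coef_sum /bounded_partitions.
under [RHS]eq_bigl => J do rewrite inE andbT.
rewrite [RHS]big_mkcondr; apply: eq_bigr => J _.
by rewrite coefZ coefXn eq_sym; case: eqP => _; rewrite ?mulr1 ?mulr0.
Qed.

End Counting.

Lemma genfun_mod4 (R : comNzRingType) (k M : nat) (P : pred nat) (e : R) :
  ~~ P 0 ->
  (\prod_(n < (M + M + (M + M)).+1 | P n) (1 + e *: 'X^n) ^+ k
  = (\prod_(i < M) (if P (4 * i + 1)%N then 1 + e *: 'X^(4 * i + 1) else 1)
     * \prod_(i < M) (if P (4 * i + 2)%N then 1 + e *: 'X^(4 * i + 2) else 1)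
     * \prod_(i < M) (if P (4 * i + 3)%N then 1 + e *: 'X^(4 * i + 3) else 1)
     * \prod_(i < M) (if P (4 * i + 4)%N then 1 + e *: 'X^(4 * i + 4) else 1))
    ^+ k)%R.
Proof.
move=> P0; rewrite prodrXl big_mkcond big_ord_recl /= (negbTE P0) mul1r.
by rewrite (big_mod4 (fun n => if P n then 1 + e *: 'X^n else 1)%R).
Qed.

Lemma genfun_S (F : numFieldType) (M : nat) (e : F) :
  (\prod_(n < (M + M + (M + M)).+1 | (0 < n)%N && ~~ (4 %| n)%N)
     (1 + e *: 'X^n) ^+ 8
  = (prod_mod M e 1 * prod_mod M e 2 * prod_mod M e 3) ^+ 8)%R.
Proof.
rewrite (@genfun_mod4 _ _ _ (fun n => (0 < n) && ~~ (4 %| n))) //.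
congr (_ ^+ _)%R.
rewrite [X in (_ * X)%R]big1; last first.
  by move=> i _; rewrite ifF //; lia.
rewrite mulr1 /prod_mod; congr (_ * _ * _)%R; apply: eq_bigr => i _;
  by rewrite ifT //; lia.
Qed.

Lemma genfun_T (F : numFieldType) (M : nat) (e : F) :
  (\prod_(n < (M + M + (M + M)).+1 | (0 < n)%N && (n %% 4 != 2)%N)
     (1 + e *: 'X^n) ^+ 8
  = (prod_mod M e 1 * prod_mod M e 3 * prod_mod M e 4) ^+ 8)%R.
Proof.
rewrite (@genfun_mod4 _ _ _ (fun n => (0 < n) && (n %% 4 != 2))) //.
congr (_ ^+ _)%R.
rewrite [X in (_ * X * _ * _)%R]big1; last first.
  by move=> i _; rewrite ifF //; lia.
rewrite mulr1 /prod_mod; congr (_ * _ * _)%R; apply: eq_bigr => i _;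
  by rewrite ifT //; lia.
Qed.

(** Each set J contributes 1 - (-1)^#|J|, that is 2 or 0. *)
Lemma sum_odd_bounded_partitions (R : comNzRingType) (k K : nat)
    (P : pred nat) (N : nat) :
  (\sum_(J in bounded_partitions k K P N xpredT) 1 ^+ #|J|
   - \sum_(J in bounded_partitions k K P N xpredT) (-1) ^+ #|J|
  = (2 * #|bounded_partitions k K P N odd|)%:R :> R)%R.
Proof.
rewrite -sumrB mulnC natrM -sum1_card natr_sum mulr_suml big_mkcond.
rewrite [RHS]big_mkcond; apply: eq_bigr => J _; rewrite !inE andbT.
rewrite expr1n -signr_odd andbA; case: (_ && _) => //=.
case: (odd _); first by rewrite expr1 opprK mul1r.
by rewrite expr0 subrr.
Qed.

Theorem theorem3p10 (N : nat) : 2 <= N -> D_S N = 8 * D_T (N - 2).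
Proof.
move=> le2N; pose M := N.+1; pose K := (M + M + (M + M)).+1.
have ltNK : N < K by rewrite /K /M; lia.
pose PS n := (0 < n) && ~~ (4 %| n); pose PT n := (0 < n) && (n %% 4 != 2).
have -> : D_S N = #|bounded_partitions 8 K PS N odd|.
  by apply: num_partitions => // n; split=> /andP.
have -> : D_T (N - 2) = #|bounded_partitions 8 K PT (N - 2) xpredT|.
  rewrite -(@num_partitions _ _ _ _ _ [set n | 0 < n /\ n %% 4 != 2]%classic).
  - by congr num_elements; apply/seteqP; split=> [A | A []].
  - by rewrite (leq_ltn_trans (leq_subr _ _)).
  - by move=> n; split=> /andP.
(* M = N + 1 is the least truncation order that sees the coefficient of 'X^N. *)
have := @eight_power_identity rat M.
rewrite /= -!genfun_S -genfun_T => /congX_coef/(_ N (ltnSn N)).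
rewrite coefB !(@coef_genfun 8 K PS) sum_odd_bounded_partitions.
rewrite coefD -mulrA !mulr_natl !coefMn coefX mulrC coefMXn ltnNge le2N /=.
rewrite (@coef_genfun 8 K PT) (_ : (N == 1) = false); last by lia.
rewrite mul0rn add0r (eq_bigr (fun=> 1%R)) => [|J _]; last by rewrite expr1n.
rewrite sumr_const -mulrnA => /eqP.
rewrite eqr_nat => /eqP eqN.
by apply/eqP; rewrite -(@eqn_pmul2l 2) // eqN mulnA mulnC.
Qed.
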